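(* Let $B$ be a ring, let $\mathcal{C}$ be a closed subcategory of the category $\mathsf{Mod}_B$ of right $B$-modules, with associated preradical $\mathfrak{r}:\mathsf{Mod}_B\to\mathcal{C}$, and let $\mathfrak{a}=\mathfrak{r}(B_B)$. Assume that $\mathfrak{a}$ has a set of local units, and let $M\in\mathcal{C}$ be of finite support. Then $M$ is injective in $\mathsf{Mod}_B$ if and only if $M$ is injective in $\mathcal{C}$. As a consequence, given a homomorphism of rings $A\to B$ with ${}_AB$ flat, if $M$ is injective in $\mathcal{C}$, then $M$ is injective in $\mathsf{Mod}_A$.
   Context: A full subcategory $\mathcal{C}$ of $\mathsf{Mod}_B$ is closed if submodules, quotients and arbitrary direct sums of objects of $\mathcal{C}$ are in $\mathcal{C}$. Its associated preradical $\mathfrak{r}$ sends a right $B$-module $X$ to its largest submodule $\mathfrak{r}(X)$ belonging to $\mathcal{C}$; $\mathfrak{a}=\mathfrak{r}(B_B)$ is a two-sided ideal of $B$. $\mathfrak{a}$ has a set of local units if it contains a set $E$ of commuting idempotents such that for every $x\in\mathfrak{a}$ there exists $e\in E$ with $xe=ex=x$. Relative to such a set $E$, a right $B$-module $M$ is of finite support if there exists a finite subset $F\subseteq E$ such that $m\sum_{e\in F}e=m$ for every $m\in M$. $M$ is an $A$-module by restriction of scalars along $A\to B$. *)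

(* Defs.v *)
From HB Require Import structures.
From mathcomp Require Import all_boot all_order all_algebra.
From mathcomp Require Import finmap generic_quotient ring_quotient.
From mathcomp Require Import boolp classical_sets functions cardinality fsbigop.

Set Implicit Arguments.
Unset Strict Implicit.
Unset Printing Implicit Defensive.

Import GRing.Theory.

Local Open Scope ring_scope.

(* Rings are unital, associative and possibly zero (pzRingType), and ring
   morphisms preserve 1.  A right B-module is an lmodType over the converse
   ring B^c: the right action m . b is (b : B^c) *: m.  In particular
   (B^c)^o is B_B, since there (b : B^c) *: x is x * b.  A full subcategory is
   given by its class of objects. *)

Notation rmodType B := (lmodType B^c).

Section Submodule.
Variables (R : pzRingType) (X : lmodType R) (S : submodClosed X).

Definition submodule : Type := {x : X | x \in S}.
HB.instance Definition _ := SubChoice.on submodule.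
HB.instance Definition _ := [SubChoice_isSubLmodule of submodule by <:].

End Submodule.

Section DirectSum.
Variables (R : pzRingType) (I : Type) (X : I -> lmodType R).

Definition dprod : Type := forall i, X i.
HB.instance Definition _ := Choice.on dprod.

Implicit Types x y z : dprod.

Let dprod_add x y : dprod := fun i => x i + y i.
Let dprod_opp x : dprod := fun i => - x i.
Let dprod_scale (a : R) x : dprod := fun i => a *: x i.

Let dprod_addA : associative dprod_add.
Proof. by move=> x y z; apply: functional_extensionality_dep => i; exact: addrA. Qed.
Let dprod_addC : commutative dprod_add.
Proof. by move=> x y; apply: functional_extensionality_dep => i; exact: addrC. Qed.
Let dprod_add0 : left_id (fun i => 0 : X i) dprod_add.
Proof. by move=> x; apply: functional_extensionality_dep => i; exact: add0r. Qed.
Let dprod_addN : left_inverse (fun i => 0 : X i) dprod_opp dprod_add.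
Proof. by move=> x; apply: functional_extensionality_dep => i; exact: addNr. Qed.

HB.instance Definition _ :=
  GRing.isZmodule.Build dprod dprod_addA dprod_addC dprod_add0 dprod_addN.

Let dprod_scaleA a b x :
  dprod_scale a (dprod_scale b x) = dprod_scale (a * b) x.
Proof. by apply: functional_extensionality_dep => i; exact: scalerA. Qed.
Let dprod_scale1 : left_id 1 dprod_scale.
Proof. by move=> x; apply: functional_extensionality_dep => i; exact: scale1r. Qed.
Let dprod_scaleDr : right_distributive dprod_scale +%R.
Proof. by move=> a x y; apply: functional_extensionality_dep => i; exact: scalerDr. Qed.
Let dprod_scaleDl x : {morph dprod_scale^~ x : a b / a + b}.
Proof. by move=> a b; apply: functional_extensionality_dep => i; exact: scalerDl. Qed.

HB.instance Definition _ := GRing.Zmodule_isLmodule.Build R dprod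
  dprod_scaleA dprod_scale1 dprod_scaleDr dprod_scaleDl.

Definition dsum_support x : set I := [set i | x i <> 0]%classic.

Definition dsum_pred : {pred dprod} := fun x => `[< finite_set (dsum_support x) >].

Let dsum_closed : submod_closed dsum_pred.
Proof.
split; first apply/asboolP.
  by apply: (sub_finite_set _ (@finite_set0 I)) => i /=; apply.
move=> a x y /asboolP fx /asboolP fy; apply/asboolP.
apply: (@sub_finite_set _ _ (dsum_support x `|` dsum_support y)%classic).
  move=> i /= nz; have [x0|] := pselect (x i = 0); last by left.
  right=> y0; apply: nz; rewrite -[LHS]/(a *: x i + y i).
  by rewrite x0 y0 scaler0 addr0.
by rewrite finite_setU.
Qed.
HB.instance Definition _ := GRing.isSubmodClosed.Build R dprod dsum_pred dsum_closed.

Definition dsum : Type := submodule dsum_pred.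
HB.instance Definition _ := GRing.Lmodule.on dsum.

Definition dsum_coord (z : dsum) : dprod := val z.

Lemma dsum_coord_linear i : linear (fun z : dsum => dsum_coord z i).
Proof. by []. Qed.


Let dsum_single (i : I) (m : X i) : dprod := fun j =>
  if pselect (i = j) is left e then eq_rect i (fun k => X k) m j e else 0.

Let dsum_single_subproof i (m : X i) : dsum_single m \in dsum_pred.
Proof.
apply/asboolP; apply: (sub_finite_set _ (finite_set1 i)) => j /=.
by rewrite /dsum_support /= /dsum_single; case: pselect => [e _|_ []] //; exact/esym.
Qed.

Definition dsum_inj (i : I) (m : X i) : dsum :=
  exist (fun z => z \in dsum_pred) _ (dsum_single_subproof m).

(* The morphism out of the direct sum determined by the maps phi i; when each
   phi i is additive, only finitely many terms of the sum are nonzero. *)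
Definition dsum_lift (G : zmodType) (phi : forall i, X i -> G) (z : dsum) : G :=
  \sum_(i \in [set: {classic I}]%classic) phi i (dsum_coord z i).

End DirectSum.

Section DirectSumTheory.
Variables (R : pzRingType) (I : Type) (X : I -> lmodType R).

Lemma dsum_coordE (z : dsum X) i : dsum_coord z i = val z i. Proof. by []. Qed.

Lemma dsum_support_finite (z : dsum X) : finite_set (dsum_support (dsum_coord z)).
Proof. exact/asboolP/(valP z). Qed.

Lemma dsum_liftE (G : zmodType) (phi : forall i, {additive X i -> G})
    (A : set {classic I}) (z : dsum X) :
  finite_set A -> (dsum_support (dsum_coord z) `<=` A)%classic ->
  dsum_lift (fun i => phi i) z = \sum_(i \in A) phi i (dsum_coord z i).
Proof.
move=> fA sA; rewrite /dsum_lift; apply/esym/fsbig_widen => // i [_ nA] /=.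
apply: contra_notP nA => nz; apply: sA => /= z0.
by apply: nz; rewrite z0 raddf0.
Qed.

Lemma dsum_lift_is_additive (G : zmodType) (phi : forall i, {additive X i -> G}) :
  zmod_morphism (dsum_lift (fun i => phi i)).
Proof.
suff D y z : dsum_lift (fun i => phi i) (y + z) =
             dsum_lift (fun i => phi i) y + dsum_lift (fun i => phi i) z.
  by move=> y z; rewrite -{2}(subrK z y) (D (y - z)) addrK.
pose A : set {classic I} :=
  (dsum_support (dsum_coord y) `|` dsum_support (dsum_coord z))%classic.
have fA : finite_set A by rewrite finite_setU; split; exact: dsum_support_finite.
rewrite !(@dsum_liftE _ _ A) //.
- rewrite -fsbig_split //; apply: eq_fsbigr => i _ /=.
  by rewrite -raddfD.
- by move=> i; right.
- by move=> i; left.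
- move=> i /=; have [y0 nz|ny _] := pselect (dsum_coord y i = 0); last by left.
  right=> /= z0; apply: nz; rewrite -[LHS]/(dsum_coord y i + dsum_coord z i).
  by rewrite y0 z0 addr0.
Qed.

Lemma dsum_lift_inj (G : zmodType) (phi : forall i, {additive X i -> G}) i m :
  dsum_lift (fun i => phi i) (dsum_inj (i := i) m) = phi i m.
Proof.
rewrite (@dsum_liftE _ _ [set (i : {classic I})]%classic).
- rewrite fsbig_set1 /dsum_coord /=; case: pselect => // e.
  by rewrite (Prop_irrelevance e erefl).
- exact: finite_set1.
- by move=> j; rewrite /dsum_support /dsum_coord /=; case: pselect => [e _|_ []].
Qed.

End DirectSumTheory.

Section ModuleMaps.
Variable R : pzRingType.
Implicit Types X Y : lmodType R.

Definition submodule_incl X (S : submodClosed X) : {linear submodule S -> X} :=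
  (val : submodule S -> X).

Lemma dsum_lift_is_scalable (I : Type) (X : I -> lmodType R) (Y : lmodType R)
    (phi : forall i, {linear X i -> Y}) :
  scalable (dsum_lift (fun i => phi i)).
Proof.
move=> a z; pose A : set {classic I} := dsum_support (dsum_coord z).
have fA : finite_set A by exact: dsum_support_finite.
have sA : (dsum_support (dsum_coord (a *: z)) `<=` A)%classic.
  move=> i /=; apply: contra_not => z0.
  by rewrite -[LHS]/(a *: dsum_coord z i) z0 scaler0.
rewrite !(@dsum_liftE _ _ _ _ phi A) // !fsbig_finite // scaler_sumr.
by apply: eq_bigr => i _; rewrite -linearZ.
Qed.

HB.instance Definition _ (I : Type) (X : I -> lmodType R) (Y : lmodType R)
    (phi : forall i, {linear X i -> Y}) :=
  GRing.isZmodMorphism.Build (dsum X) Y (dsum_lift (fun i => phi i))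
    (dsum_lift_is_additive phi).
HB.instance Definition _ (I : Type) (X : I -> lmodType R) (Y : lmodType R)
    (phi : forall i, {linear X i -> Y}) :=
  GRing.isScalable.Build R (dsum X) Y *:%R (dsum_lift (fun i => phi i))
    (dsum_lift_is_scalable phi).

Definition lin_image X Y (f : {linear X -> Y}) : {pred Y} :=
  fun y => `[< exists x, f x = y >].

Lemma lin_image_closed X Y (f : {linear X -> Y}) : submod_closed (lin_image f).
Proof.
split; first by apply/asboolP; exists 0; rewrite linear0.
move=> a _ _ /asboolP[x <-] /asboolP[y <-]; apply/asboolP.
by exists (a *: x + y); rewrite linearP.
Qed.
HB.instance Definition _ X Y (f : {linear X -> Y}) :=
  GRing.isSubmodClosed.Build R Y (lin_image f) (lin_image_closed f).

Definition lin_kernel X Y (f : {linear X -> Y}) : {pred X} := fun x => f x == 0.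

Lemma lin_kernel_closed X Y (f : {linear X -> Y}) : submod_closed (lin_kernel f).
Proof.
split; first by rewrite /lin_kernel unfold_in linear0.
move=> a x y /eqP x0 /eqP y0.
by rewrite unfold_in /lin_kernel linearP x0 y0 scaler0 addr0.
Qed.
HB.instance Definition _ X Y (f : {linear X -> Y}) :=
  GRing.isSubmodClosed.Build R X (lin_kernel f) (lin_kernel_closed f).

Lemma lin_image_subproof X Y (f : {linear X -> Y}) x : f x \in lin_image f.
Proof. by apply/asboolP; exists x. Qed.

Definition lin_corestr X Y (f : {linear X -> Y}) (x : X) :
    submodule (lin_image f) :=
  exist (fun y => y \in lin_image f) _ (lin_image_subproof f x).

Lemma lin_corestr_is_linear X Y (f : {linear X -> Y}) : linear (lin_corestr f).
Proof. by move=> a x y; apply: val_inj; rewrite /= linearP. Qed.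
HB.instance Definition _ X Y (f : {linear X -> Y}) :=
  GRing.isLinear.Build R X (submodule (lin_image f)) *:%R (lin_corestr f)
    (lin_corestr_is_linear f).

Lemma lin_corestr_surj X Y (f : {linear X -> Y}) y : exists x, lin_corestr f x = y.
Proof.
case: y => y yf; have /asboolP[x fx] := yf; exists x.
by apply: val_inj.
Qed.

End ModuleMaps.

Section ClosedSubcategory.
Variable R : pzRingType.
Implicit Types (X Y Z M : lmodType R) (C : lmodType R -> Prop).

(* Submodules and quotients are taken up to isomorphism, as the sources of
   injective and the targets of surjective linear maps, so that C is closed
   under isomorphism. *)
Record closed_subcategory C : Prop := ClosedSubcategory {
  closed_sub : forall X Y (f : {linear Y -> X}), C X -> injective f -> C Y;
  closed_quotient : forall X Y (f : {linear X -> Y}),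
    C X -> (forall y, exists x, f x = y) -> C Y;
  closed_dsum : forall (I : Type) (X : I -> lmodType R),
    (forall i, C (X i)) -> C (dsum X)
}.

(* The largest submodule of X belonging to C, as the union of all such
   submodules; see preradical_largest. *)
Definition preradical C X : set X :=
  [set x | exists2 S : submodClosed X, C (submodule S) & x \in S]%classic.

Arguments preradical C X : clear implicits.

Lemma preradical_largest C X : closed_subcategory C ->
  exists S : submodClosed X,
    [/\ forall x, x \in S <-> preradical C X x,
        C (submodule S) &
        forall T : submodClosed X, C (submodule T) -> {subset T <= S}].
Proof.
move=> [_ Cquo Cdsum].
pose I := {T : submodClosed X | C (submodule T)}.
pose F (i : I) : lmodType R := submodule (sval i).
pose phi (i : I) : {linear F i -> X} := submodule_incl (sval i).
pose f : {linear dsum F -> X} := dsum_lift (fun i => phi i).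
have CS : C (submodule (lin_image f)).
  apply: (Cquo _ _ (lin_corestr f)); last exact: lin_corestr_surj.
  by apply: Cdsum => -[].
have sub (T : submodClosed X) : C (submodule T) -> {subset T <= lin_image f}.
  move=> CT x xT; apply/asboolP.
  pose i : I := exist _ T CT.
  exists (@dsum_inj _ _ F i (exist (fun x => x \in T) x xT)).
  by rewrite [LHS](dsum_lift_inj phi).
pose S : submodClosed X := lin_image f.
exists S; split=> // x; split=> [xS|[T CT]]; last exact: sub.
by exists S.
Qed.

(* Injectivity in C is meant in the categorical sense, against the
   monomorphisms of the full subcategory C; when C is closed these are the
   injective maps (monic_inP). *)
Definition monic_in C X Y (f : {linear X -> Y}) : Prop :=
  forall Z, C Z -> forall u v : {linear Z -> X}, f \o u =1 f \o v -> u =1 v.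

Definition injective_in C M : Prop :=
  forall X Y (f : {linear X -> Y}), C X -> C Y -> monic_in C f ->
  forall g : {linear X -> M}, exists h : {linear Y -> M}, h \o f =1 g.

Lemma monic_inP C X Y (f : {linear X -> Y}) : closed_subcategory C -> C X ->
  monic_in C f <-> injective f.
Proof.
move=> [Csub _ _] CX; split=> [mf|injf Z _ u v fuv z]; last exact/injf/fuv.
have CK : C (submodule (lin_kernel f)).
  exact: (Csub _ _ (submodule_incl (lin_kernel f))) CX val_inj.
pose K := submodule (lin_kernel f).
have f0 x : f x = 0 -> x = 0.
  move=> /eqP xK.
  have := mf K CK (submodule_incl (lin_kernel f)) (GRing.null_fun _).
  move/(_ _ (exist (fun x => x \in lin_kernel f) x xK)); apply=> -[y /= /eqP yK].
  by rewrite /= yK linear0.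
by move=> x y fxy; apply/eqP; rewrite -subr_eq0; apply/eqP/f0; rewrite linearB fxy subrr.
Qed.

Lemma closed_subcategory_all : closed_subcategory (fun _ : lmodType R => True).
Proof. by []. Qed.

End ClosedSubcategory.

Definition Mod (B : pzRingType) : rmodType B -> Prop := fun _ => True.

Section Tensor.
Variables (A : pzRingType) (X : rmodType A) (N : lmodType A).

Record balanced (G : zmodType) (beta : X -> N -> G) : Prop := Balanced {
  balancedDl : forall x y n, beta (x + y) n = beta x n + beta y n;
  balancedDr : forall x n p, beta x (n + p) = beta x n + beta x p;
  balancedM : forall x (a : A) n, beta ((a : A^c) *: x) n = beta x (a *: n)
}.

Definition tensor_free : Type := dsum (fun _ : X * N => int^o : lmodType int).
HB.instance Definition _ := GRing.Lmodule.on tensor_free.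

Definition tensor_gen (x : X) (n : N) : tensor_free :=
  dsum_inj (X := fun _ : X * N => int^o) (i := (x, n)) 1.

Inductive tensor_rel : tensor_free -> Prop :=
| tensor_relDl x y n :
    tensor_rel (tensor_gen (x + y) n - (tensor_gen x n + tensor_gen y n))
| tensor_relDr x n p :
    tensor_rel (tensor_gen x (n + p) - (tensor_gen x n + tensor_gen x p))
| tensor_relM x (a : A) n :
    tensor_rel (tensor_gen ((a : A^c) *: x) n - tensor_gen x (a *: n)).

Definition tensor_subgroup : {pred tensor_free} := fun z =>
  `[< forall H : zmodClosed tensor_free,
        (forall r, tensor_rel r -> r \in H) -> z \in H >].

Lemma tensor_subgroup_closed : zmod_closed tensor_subgroup.
Proof.
split; first by apply/asboolP => H _; exact: rpred0.
move=> y z /asboolP Hy /asboolP Hz; apply/asboolP => H rH.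
by rewrite rpredB ?Hy ?Hz.
Qed.
HB.instance Definition _ :=
  GRing.isZmodClosed.Build tensor_free tensor_subgroup tensor_subgroup_closed.

Lemma tensor_rel_subgroup r : tensor_rel r -> r \in tensor_subgroup.
Proof. by move=> rr; apply/asboolP => H; apply. Qed.

(* X (x)_A N: the free abelian group on X * N modulo the subgroup generated by
   the balancing relations. *)
Definition tensor : Type := Quotient.quot tensor_subgroup.
HB.instance Definition _ := GRing.Zmodule.on tensor.

Definition tensor_pi (z : tensor_free) : tensor := \pi_(Quotient.quot tensor_subgroup)%qT z.

Lemma tensor_pi_is_additive : zmod_morphism tensor_pi.
Proof. by move=> y z; rewrite /tensor_pi !piE. Qed.
HB.instance Definition _ :=
  GRing.isZmodMorphism.Build tensor_free tensor tensor_pi tensor_pi_is_additive.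

Lemma tensor_pi_eq y z : tensor_pi y = tensor_pi z <-> y - z \in tensor_subgroup.
Proof. by rewrite Quotient.idealrBE; split=> [/eqP|/eqP]. Qed.

Definition tens (x : X) (n : N) : tensor := tensor_pi (tensor_gen x n).

Lemma tens_balanced : balanced tens.
Proof.
split=> *; rewrite /tens -?raddfD; apply/tensor_pi_eq/tensor_rel_subgroup.
- exact: tensor_relDl.
- exact: tensor_relDr.
- exact: tensor_relM.
Qed.

(* The additive map sending tens x n to beta x n; well defined when beta is
   balanced. *)
Definition tensor_lift (G : zmodType) (beta : X -> N -> G) (t : tensor) : G :=
  dsum_lift (X := fun _ : X * N => int^o) (fun p k => beta p.1 p.2 *~ (k : int))
    (repr (t : Quotient.quot tensor_subgroup)).

Section Lift.
Variables (G : zmodType) (beta : X -> N -> G) (bal : balanced beta).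

Let phi (p : X * N) (k : int^o) : G := beta p.1 p.2 *~ k.
Let phi_additive p : zmod_morphism (phi p).
Proof. by move=> k l; rewrite /phi mulrzBr. Qed.
HB.instance Definition _ p :=
  GRing.isZmodMorphism.Build int^o G (phi p) (phi_additive p).

Let lift0 : tensor_free -> G := dsum_lift (fun p => phi p).
Let lift0_additive : zmod_morphism lift0.
Proof. exact: (dsum_lift_is_additive (fun p => phi p : {additive int^o -> G})). Qed.
HB.instance Definition _ :=
  GRing.isZmodMorphism.Build tensor_free G lift0 lift0_additive.

Let lift0_gen x n : lift0 (tensor_gen x n) = beta x n.
Proof.
rewrite /lift0 /tensor_gen.
rewrite (dsum_lift_inj (fun p => phi p : {additive int^o -> G})).
by rewrite /= /phi mulr1z.
Qed.

Let lift0_ker z : z \in tensor_subgroup -> lift0 z = 0.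
Proof.
move=> /asboolP zI; pose H : {pred tensor_free} := fun z => lift0 z == 0.
have Hc : zmod_closed H.
  split; first by rewrite unfold_in /H raddf0.
  by move=> x y /eqP x0 /eqP y0; rewrite unfold_in /H raddfB /= x0 y0 subr0.
pose HH : zmodClosed tensor_free :=
  HB.pack H (GRing.isZmodClosed.Build tensor_free H Hc).
suff /eqP : z \in HH by [].
apply: zI => _ [x y n|x n p|x a n]; rewrite unfold_in /= /H.
- by rewrite raddfB raddfD /= !lift0_gen (balancedDl bal) subrr.
- by rewrite raddfB raddfD /= !lift0_gen (balancedDr bal) subrr.
- by rewrite raddfB /= !lift0_gen (balancedM bal) subrr.
Qed.

Lemma tensor_lift_pi z : tensor_lift beta (tensor_pi z) = lift0 z.
Proof.
apply/eqP; rewrite -subr_eq0 -[X in X - _]/(lift0 _) -raddfB.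
by apply/eqP/lift0_ker; rewrite Quotient.idealrBE reprK.
Qed.

Lemma tensor_lift_tens x n : tensor_lift beta (tens x n) = beta x n.
Proof. by rewrite tensor_lift_pi lift0_gen. Qed.

Lemma tensor_lift_is_additive : zmod_morphism (tensor_lift beta).
Proof.
move=> s t; rewrite -(reprK s) -(reprK t) -!/(tensor_pi _).
by rewrite -raddfB !tensor_lift_pi raddfB.
Qed.

End Lift.

End Tensor.

Section Flat.
Variable A : pzRingType.
Implicit Types (X Y Z : rmodType A) (N : lmodType A).

(* f (x)_A id_N *)
Definition tensor_map X Y N (f : {linear X -> Y}) : tensor X N -> tensor Y N :=
  tensor_lift (fun x n => tens (f x) n).

Lemma tensor_map_balanced X Y N (f : {linear X -> Y}) :
  balanced (fun x (n : N) => tens (f x) n).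
Proof.
have [bDl bDr bM] := @tens_balanced A Y N.
by split=> *; rewrite ?linearD ?linearZ ?bDl ?bDr ?bM.
Qed.

Lemma tensor_map_tens X Y N (f : {linear X -> Y}) x (n : N) :
  tensor_map f (tens x n) = tens (f x) n.
Proof. exact: (tensor_lift_tens (@tensor_map_balanced X Y N f)). Qed.

Lemma tensor_map_is_additive X Y N (f : {linear X -> Y}) :
  zmod_morphism (@tensor_map X Y N f).
Proof. exact: (tensor_lift_is_additive (@tensor_map_balanced X Y N f)). Qed.

Definition exact_at (U V W : zmodType) (f : U -> V) (g : V -> W) : Prop :=
  forall v, g v = 0 <-> exists u, f u = v.

(* The functor - (x)_A N is exact. *)
Definition flat N : Prop :=
  forall X Y Z (f : {linear X -> Y}) (g : {linear Y -> Z}),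
    exact_at f g ->
    exact_at (@tensor_map X Y N f) (@tensor_map Y Z N g).

End Flat.

Definition restr_scalars (A B : pzRingType) (f : {rmorphism A -> B})
  (M : lmodType B) : Type := M.

Section RestrictionOfScalars.
Variables (A B : pzRingType) (f : {rmorphism A -> B}) (M : lmodType B).

HB.instance Definition _ := GRing.Zmodule.copy (restr_scalars f M) M.

Let rscale (a : A) (m : restr_scalars f M) : restr_scalars f M := f a *: (m : M).

Let rscaleA a b m : rscale a (rscale b m) = rscale (a * b) m.
Proof. by rewrite /rscale scalerA rmorphM. Qed.
Let rscale1 : left_id 1 rscale.
Proof. by move=> m; rewrite /rscale rmorph1 scale1r. Qed.
Let rscaleDr : right_distributive rscale +%R.
Proof. by move=> a x y; exact: scalerDr. Qed.
Let rscaleDl m : {morph rscale^~ m : a b / a + b}.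
Proof. by move=> a b; rewrite /rscale rmorphD scalerDl. Qed.

HB.instance Definition _ := GRing.Zmodule_isLmodule.Build A (restr_scalars f M)
  rscaleA rscale1 rscaleDr rscaleDl.

End RestrictionOfScalars.

Definition converse_morphism (A B : pzRingType) (f : {rmorphism A -> B}) :
  A^c -> B^c := f.

Section ConverseMorphism.
Variables (A B : pzRingType) (f : {rmorphism A -> B}).

Let conv_additive : zmod_morphism (converse_morphism f).
Proof. exact: (raddfB f). Qed.
Let conv_monoid : monoid_morphism (converse_morphism f).
Proof. by split=> [|a b]; [exact: (rmorph1 f) | exact: (rmorphM f)]. Qed.

HB.instance Definition _ :=
  GRing.isZmodMorphism.Build A^c B^c (converse_morphism f) conv_additive.
HB.instance Definition _ :=
  GRing.isMonoidMorphism.Build A^c B^c (converse_morphism f) conv_monoid.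

End ConverseMorphism.

(* B as a left A-module (a acts on b as f a * b), and a right B-module M as a
   right A-module. *)
Definition left_regular_along (A B : pzRingType) (f : {rmorphism A -> B}) :
  lmodType A := restr_scalars f B^o.
Definition right_restr (A B : pzRingType) (f : {rmorphism A -> B})
  (M : rmodType B) : rmodType A := @restr_scalars A^c B^c (converse_morphism f) M.

Definition right_regular (B : pzRingType) : rmodType B := (B^c)^o.

Section RightModules.
Variable B : pzRingType.
Implicit Types (C : rmodType B -> Prop) (M : rmodType B) (E : set B).

(* r(B_B), as a subset of B *)
Definition preradical_ideal C : set B := @preradical B^c C (right_regular B).

Lemma preradical_ideal_two_sided C : closed_subcategory C ->
  [/\ preradical_ideal C 0,
      forall x y, preradical_ideal C x -> preradical_ideal C y ->
        preradical_ideal C (x - y) &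
      forall b x, preradical_ideal C x ->
        preradical_ideal C (x * b) /\ preradical_ideal C (b * x)].
Proof.
move=> Ccl; have [S [SE CS Smax]] := preradical_largest (right_regular B) Ccl.
split; first by apply/SE; exact: rpred0.
  by move=> x y /SE xS /SE yS; apply/SE; exact: ((GRing.submod_closedB (submodClosedP S)).2 x y xS yS).
move=> b x /SE xS; split; apply/SE; first exact: (GRing.subsemimod_closedZ (GRing.submod_closed_semi (submodClosedP S)) (b : B^c) xS).
pose mb (z : submodule S) : (right_regular B) := b * (val z : B).
have mb_lin : linear mb.
  by move=> a y z; rewrite /mb /= mulrDr; congr (_ + _); exact: (mulrA b).
pose g : {linear submodule S -> (right_regular B)} :=
  HB.pack mb (GRing.isLinear.Build B^c (submodule S) (right_regular B) *:%R mb mb_lin).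
pose T : submodClosed (right_regular B) := lin_image g.
apply: (Smax T); last by apply/asboolP; exists (exist (fun z => z \in S) x xS).
by apply: (@closed_quotient _ _ Ccl _ _ (lin_corestr g) CS); exact: lin_corestr_surj.
Qed.

Definition local_units (a E : set B) : Prop :=
  [/\ (E `<=` a)%classic,
      forall e, E e -> e * e = e,
      forall e e', E e -> E e' -> e * e' = e' * e &
      forall x, a x -> exists2 e, E e & x * e = x /\ e * x = x].

Definition finite_support E M : Prop :=
  exists2 F : {fset B}, (forall e, e \in F -> E e) &
    forall m : M, (\sum_(e <- F) e : B^c) *: m = m.

End RightModules.

(* Main.v *)
(* Since M has finite support, a single idempotent e of E acts as the identity
   on M.  Given X -> Y injective and g : X -> M, the elements of X landing in
   r(Y) form an object of C, so g extends there to h : r(Y) -> M, and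
   y |-> h (y e) is defined on all of Y because Y a is contained in r(Y).  It is
   B-linear: h (y b e) = h (y t b e) = h (y t) b e for any t in a with t e = e
   and t b e = b e, and h (y t) = h (y t) e = h (y e).
   The statement over A follows because injectivity passes to the right adjoint
   of the functor - (x)_A B, which preserves monomorphisms when B is flat. *)
From HB Require Import structures.
From mathcomp Require Import all_boot all_order all_algebra.
From mathcomp Require Import finmap.
From mathcomp Require Import boolp classical_sets cardinality fsbigop.
Require Import Defs.

Set Implicit Arguments.
Unset Strict Implicit.
Unset Printing Implicit Defensive.

Import GRing.Theory.

Local Open Scope ring_scope.

(** * Extension of morphisms from r(Y) to Y *)

Section ClosedSubcategoryInjective.
Variable R : pzRingType.
Implicit Types (C : lmodType R -> Prop) (X Y M : lmodType R).

(** In a closed subcategory the monomorphisms are the injective maps, so a monomorphism of [C] is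
    still one in [C']. *)
Lemma injective_in_sub C C' M : closed_subcategory C -> closed_subcategory C' ->
  (forall X, C X -> C' X) -> injective_in C' M -> injective_in C M.
Proof.
move=> Ccl C'cl CC' injM X Y f CX CY mf; apply: injM; [exact: CC'|exact: CC'|].
by apply/(monic_inP f C'cl (CC' _ CX)); apply/(monic_inP f Ccl CX).
Qed.

(** The map [z |-> z *: y] carries a submodule in [C] containing [r] onto a quotient of it, hence
    onto a submodule of [Y] in [C]. For [R = B^c] this says that Y a lies in r(Y). *)
Lemma preradical_scale C Y (r : R^o) (y : Y) : closed_subcategory C ->
  preradical C r -> preradical C ((r : R) *: y).
Proof.
move=> Ccl [S CS rS].
pose act (z : submodule S) : Y := (val z : R) *: y.
have act_lin : linear act.
  by move=> a u v; rewrite /act /= scalerDl scalerA.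
pose g : {linear submodule S -> Y} :=
  HB.pack act (GRing.isLinear.Build R (submodule S) Y *:%R act act_lin).
pose T : submodClosed Y := lin_image g; exists T.
  by apply: (closed_quotient Ccl (f := lin_corestr g) CS); exact: lin_corestr_surj.
by apply/asboolP; exists (exist (fun z => z \in S) r rS).
Qed.

Definition lin_preim X Y (f : {linear X -> Y}) (S : submodClosed Y) : {pred X} :=
  fun x => f x \in S.

Lemma lin_preim_closed X Y (f : {linear X -> Y}) (S : submodClosed Y) :
  submod_closed (lin_preim f S).
Proof.
split; first by rewrite unfold_in /lin_preim linear0 rpred0.
by move=> a x y xS yS; rewrite unfold_in /lin_preim linearP rpredD ?rpredZ.
Qed.
HB.instance Definition _ X Y (f : {linear X -> Y}) (S : submodClosed Y) :=
  GRing.isSubmodClosed.Build R X (lin_preim f S) (lin_preim_closed f S).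

Definition lin_restr X Y (f : {linear X -> Y}) (S : submodClosed Y)
    (x : submodule (lin_preim f S)) : submodule S :=
  exist (fun y => y \in S) (f (val x)) (valP x).

Lemma lin_restr_is_linear X Y (f : {linear X -> Y}) (S : submodClosed Y) :
  linear (@lin_restr X Y f S).
Proof. by move=> a x y; apply: val_inj; rewrite /= linearP. Qed.
HB.instance Definition _ X Y (f : {linear X -> Y}) (S : submodClosed Y) :=
  GRing.isLinear.Build R (submodule (lin_preim f S)) (submodule S) *:%R
    (@lin_restr X Y f S) (@lin_restr_is_linear X Y f S).

(* In the application R is B^c, so that e * t here is the product t e of B. *)
Lemma injective_in_all C M (e : R) : closed_subcategory C ->
  preradical C (e : R^o) -> (forall m : M, e *: m = m) ->
  (forall r, exists2 t : R, preradical C (t : R^o) &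
     e * t = e /\ e * r * t = e * r) ->
  injective_in C M -> injective_in (fun=> True) M.
Proof.
move=> Ccl ae eM units injM X Y f _ _ mf g.
have injf : injective f by apply/(monic_inP f (@closed_subcategory_all R) I).
have [S [SE CS _]] := preradical_largest Y Ccl.
have aS (r : R) (y : Y) : preradical C (r : R^o) -> r *: y \in S.
  by move=> ar; apply/SE/preradical_scale.
pose fS : {linear submodule (lin_preim f S) -> submodule S} := @lin_restr X Y f S.
have injfS : injective fS by move=> x y [/injf xy]; exact: val_inj.
(* The preimage of r(Y) under [f] embeds in r(Y), hence lies in [C]. *)
have CP := closed_sub Ccl CS injfS.
have mfS : monic_in C fS by apply/(monic_inP fS Ccl CP).
have [h hE] := injM _ _ fS CP CS mfS (g \o submodule_incl (lin_preim f S)).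
pose act (r : R) (ar : preradical C (r : R^o)) (y : Y) : submodule S :=
  exist (fun z => z \in S) (r *: y) (aS r y ar).
pose H y : M := h (act e ae y).
have Hadd y z : H (y + z) = H y + H z.
  by rewrite /H -linearD; congr (h _); apply: val_inj; rewrite /= scalerDr.
have Hscale r y : H (r *: y) = r *: H y.
  have [t at_ [et ert]] := units r.
  have -> : H (r *: y) = (e * r) *: h (act t at_ y).
    rewrite -linearZ; congr (h _); apply: val_inj => /=.
    by rewrite !scalerA ert.
  rewrite -scalerA eM -[h (act t _ _)]eM -linearZ; congr (_ *: h _).
  by apply: val_inj; rewrite /= scalerA et.
have Hlin : linear H by move=> r y z; rewrite Hadd Hscale.
pose HL : {linear Y -> M} := HB.pack H (GRing.isLinear.Build R Y M *:%R H Hlin).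
exists HL => x /=.
(* [x] itself may lie outside the preimage of r(Y), but [e *: x] is inside, and
   [g (e *: x) = e *: g x = g x]. *)
have exP : e *: x \in lin_preim f S by rewrite unfold_in /lin_preim linearZ aS.
have := hE (exist (fun x => x \in lin_preim f S) (e *: x) exP).
rewrite /= linearZ_LR eM => <-; rewrite /H; congr (h _).
by apply: val_inj; rewrite /= linearZ.
Qed.

End ClosedSubcategoryInjective.

(** * Consequences of local units in a *)

Section LocalUnits.
Variable B : pzRingType.
Implicit Types (C : rmodType B -> Prop) (M : rmodType B) (E : set B).

(** The sum s of [F] lies in the ideal, so some [e] in [E] satisfies s e = s; then m e = (m s) e = m
    s = m. *)
Lemma finite_support_unit C E M : closed_subcategory C ->
  local_units (preradical_ideal C) E -> finite_support E M ->
  exists2 e, E e & forall m : M, (e : B^c) *: m = m.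
Proof.
move=> Ccl [Ea _ _ Eu] [F FE Fid].
have [a0 aB _] := preradical_ideal_two_sided Ccl.
have aD x y : preradical_ideal C x -> preradical_ideal C y ->
    preradical_ideal C (x + y).
  by move=> ax ay; rewrite -[y]opprK; apply: (aB) => //; rewrite -sub0r; exact: aB.
have aF : preradical_ideal C (\sum_(e <- F) e).
  by rewrite big_seq; elim/big_ind: _ => // e /FE /Ea.
have [e Ee [Fe _]] := Eu _ aF; exists e => // m.
by rewrite -[in LHS](Fid m) scalerA -[X in X *: m]/((\sum_(e <- F) e) * e) Fe Fid.
Qed.

Lemma local_units_join C E (e x : B) : closed_subcategory C ->
  local_units (preradical_ideal C) E -> E e -> preradical_ideal C x ->
  exists2 t, preradical_ideal C t & t * e = e /\ t * x = x.
Proof.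
move=> Ccl [Ea Ei Ec Eu] Ee ax.
have [a0 aB aM] := preradical_ideal_two_sided Ccl.
have [d Ed [_ dx]] := Eu _ ax.
(* The join e + d - e d of the commuting idempotents [e] and [d], where [d] fixes [x] on the
   left. *)
exists (e - (e * d - d)).
  by apply: (aB); [exact: Ea|apply: (aB); [exact: (aM _ _ (Ea _ Ee)).1|exact: Ea]].
split; last by rewrite !mulrBl -mulrA dx subKr.
by rewrite !mulrBl (Ec e d) // -mulrA !Ei // subrr subr0.
Qed.

Lemma injective_in_Mod C E M : closed_subcategory C ->
  local_units (preradical_ideal C) E -> finite_support E M ->
  injective_in C M -> injective_in (@Mod B) M.
Proof.
move=> Ccl lu fs; have [e Ee eM] := finite_support_unit Ccl lu fs.
have ae : preradical_ideal C e by case: lu => Ea *; exact: Ea.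
apply: (@injective_in_all B^c C M e) => // r.
(* The product [e * r] of [B^c] is r e in [B], which lies in the two-sided ideal; [t] is then a
   common left unit of e and r e. *)
have [_ _ /(_ r e ae)[_ are]] := preradical_ideal_two_sided Ccl.
by have [t] := local_units_join Ccl lu Ee are; exists t.
Qed.

End LocalUnits.

(** * Additive maps out of direct sums and tensor products *)

Section DirectSumGeneration.
Variables (R : pzRingType) (I : Type) (X : I -> lmodType R).

Lemma dsum_inj_is_additive i : zmod_morphism (@dsum_inj R I X i).
Proof.
move=> m n; apply: val_inj; apply: functional_extensionality_dep => j /=.
rewrite -[RHS]/(dsum_coord (dsum_inj m) j - dsum_coord (dsum_inj n) j).
by rewrite /dsum_coord /=; case: pselect => [e|_]; [case: j / e|rewrite subr0].
Qed.
HB.instance Definition _ i :=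
  GRing.isZmodMorphism.Build (X i) (dsum X) (@dsum_inj R I X i)
    (@dsum_inj_is_additive i).

Lemma dsum_coord_is_additive i :
  zmod_morphism (fun z : dsum X => dsum_coord z i).
Proof. by []. Qed.

Lemma dsum_lift_id (z : dsum X) : dsum_lift (fun i => @dsum_inj R I X i) z = z.
Proof.
apply: val_inj; apply: functional_extensionality_dep => j.
rewrite -![val _ j]/(dsum_coord _ j).
(* Adjoining [j] to the support lets the sum of [j]-th coordinates shrink to the singleton of [j],
   even when that coordinate of [z] is zero. *)
pose A : set {classic I} :=
  (dsum_support (dsum_coord z) `|` [set (j : {classic I})])%classic.
have fA : finite_set A.
  by rewrite finite_setU; split; [exact: dsum_support_finite|exact: finite_set1].
rewrite (@dsum_liftE _ _ _ _ (fun i => @dsum_inj R I X i) A) //;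
  last by move=> i; left.
pose coordj : {additive dsum X -> X j} := HB.pack (fun z : dsum X => dsum_coord z j)
  (GRing.isZmodMorphism.Build (dsum X) (X j) _ (dsum_coord_is_additive j)).
rewrite fsbig_finite // [LHS](raddf_sum coordj) -fsbig_finite //=.
rewrite -(@fsbig_widen _ _ _ _ [set (j : {classic I})]%classic).
- rewrite fsbig_set1 /dsum_coord /=; case: pselect => // e.
  by rewrite (Prop_irrelevance e erefl).
- by move=> i ->; right.
- by move=> i [_ ji]; rewrite /dsum_coord /=; case: pselect => // e; case: ji.
Qed.

(** By [dsum_lift_id], [z] is a finite sum of elements [dsum_inj m]. *)
Lemma dsum_ext (G : zmodType) (u v : {additive dsum X -> G}) :
  (forall i m, u (dsum_inj (i := i) m) = v (dsum_inj (i := i) m)) -> u =1 v.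
Proof.
move=> uv z; rewrite -(dsum_lift_id z).
have fz := dsum_support_finite z.
rewrite (@dsum_liftE _ _ _ _ (fun i => @dsum_inj R I X i) _ _ fz) //.
rewrite fsbig_finite // !raddf_sum; apply: eq_bigr => i _; exact: uv.
Qed.

End DirectSumGeneration.

(** The pure tensors generate the tensor product as a group. Additivity is a hypothesis on bare
    functions, so that both sides of a module law can be compared directly. *)
Lemma tensor_ext (A : pzRingType) (X : rmodType A) (N : lmodType A)
    (G : zmodType) (u v : tensor X N -> G) :
  zmod_morphism u -> zmod_morphism v ->
  (forall x n, u (tens x n) = v (tens x n)) -> u =1 v.
Proof.
move=> uB vB uv t.
pose u' : {additive tensor X N -> G} :=
  HB.pack u (GRing.isZmodMorphism.Build _ _ u uB).
pose v' : {additive tensor X N -> G} :=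
  HB.pack v (GRing.isZmodMorphism.Build _ _ v vB).
pose piXN : {additive tensor_free X N -> tensor X N} := @tensor_pi A X N.
rewrite -(reprK t) -/(tensor_pi _).
apply: (dsum_ext (u := u' \o piXN) (v := v' \o piXN)) => -[x n] k.
(* An integer coefficient [k] is [k] times 1, so additivity reduces the claim to the generator
   [tensor_gen x n]. *)
by rewrite -[k]intz !raddfMz /= uv.
Qed.

(** * Extension of scalars along A -> B and its adjunction with restriction *)

Section ExtensionOfScalars.
Variables (A B : pzRingType) (f : {rmorphism A -> B}).
Implicit Types (X Y : rmodType A) (M : rmodType B).

Local Notation N := (left_regular_along f).

(** A separate name for the tensor product with B, to carry the right B-module structure acting on
    the second factor. *)
Definition ext_scalars X : Type := tensor X N.
HB.instance Definition _ X := GRing.Zmodule.on (ext_scalars X).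

Section Action.
Variable X : rmodType A.

Definition ext_act (b : B) : ext_scalars X -> ext_scalars X :=
  tensor_lift (fun x (n : N) => tens x ((n : B) * b : N)).

Lemma ext_act_balanced (b : B) :
  balanced (fun (x : X) (n : N) => tens x ((n : B) * b : N)).
Proof.
have [bDl bDr bM] := @tens_balanced A X N.
split=> *; first exact: bDl; first by rewrite -bDr -mulrDl.
by rewrite bM; congr tens; exact: mulrA.
Qed.

Lemma ext_act_tens b x (n : N) : ext_act b (tens x n) = tens x ((n : B) * b : N).
Proof. exact: (tensor_lift_tens (ext_act_balanced b)). Qed.

Lemma ext_act_additive b : zmod_morphism (ext_act b).
Proof. exact: (tensor_lift_is_additive (ext_act_balanced b)). Qed.

Let scale (b : B^c) (t : ext_scalars X) : ext_scalars X := ext_act b t.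

Let scaleA a b t : scale a (scale b t) = scale (a * b) t.
Proof.
move: t; apply: tensor_ext => [s t|s t|x n].
- by rewrite /scale !ext_act_additive.
- exact: ext_act_additive.
- by rewrite /scale !ext_act_tens -mulrA.
Qed.
Let scale1 : left_id 1 scale.
Proof.
apply: tensor_ext => [s t|s t|x n] //; first exact: ext_act_additive.
by rewrite /scale ext_act_tens mulr1.
Qed.
Let scaleDr : right_distributive scale +%R.
Proof.
move=> b s t; pose G : {additive ext_scalars X -> ext_scalars X} :=
  HB.pack (ext_act b) (GRing.isZmodMorphism.Build _ _ _ (ext_act_additive b)).
exact: (raddfD G).
Qed.
Let scaleDl t : {morph scale^~ t : a b / a + b}.
Proof.
move=> a b /=; move: t; apply: tensor_ext => [s t|s t|x n].
- exact: ext_act_additive.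
- by rewrite /scale !ext_act_additive opprD addrACA.
- have [_ bDr _] := @tens_balanced A X N.
  by rewrite /scale !ext_act_tens mulrDr -bDr.
Qed.
HB.instance Definition _ := GRing.Zmodule_isLmodule.Build B^c (ext_scalars X)
  scaleA scale1 scaleDr scaleDl.

Lemma ext_scaleE (b : B^c) x (n : N) :
  b *: (tens x n : ext_scalars X) = tens x ((n : B) * (b : B) : N).
Proof. exact: ext_act_tens. Qed.

End Action.

Definition ext_map X Y (g : {linear X -> Y}) : ext_scalars X -> ext_scalars Y :=
  tensor_map g.

Lemma ext_map_is_linear X Y (g : {linear X -> Y}) : linear (ext_map g).
Proof.
have gB := @tensor_map_is_additive A X Y N g.
pose G : {additive ext_scalars X -> ext_scalars Y} :=
  HB.pack (ext_map g) (GRing.isZmodMorphism.Build _ _ _ gB).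
move=> b s t; rewrite -![ext_map g _]/(G _) raddfD; congr (_ + _).
move: s; apply: tensor_ext => [s u|s u|x n].
- by rewrite scalerBr raddfB.
- by rewrite raddfB scalerBr.
- by rewrite ext_scaleE /= /ext_map !tensor_map_tens ext_scaleE.
Qed.
HB.instance Definition _ X Y (g : {linear X -> Y}) :=
  GRing.isLinear.Build B^c (ext_scalars X) (ext_scalars Y) *:%R (ext_map g)
    (ext_map_is_linear g).

Lemma ext_map_inj X Y (g : {linear X -> Y}) : flat N -> injective g ->
  injective (ext_map g).
Proof.
move=> Nflat injg.
(* Flatness is exactness at a middle term, so injectivity of [g] is encoded as exactness at [X],
   with the zero endomorphism of [X] in place of the map from 0. *)
have ex : exact_at (GRing.null_fun X : {linear X -> X}) g.
  move=> x; split=> [gx|[u <-]]; last by rewrite linear0.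
  by exists 0; apply: injg; rewrite gx linear0.
move=> s t /eqP; rewrite -subr_eq0 -linearB => /eqP /(Nflat _ _ _ _ _ ex).
case=> v; set O := GRing.null_fun X.
(* [tens 0 n] vanishes, since [tens (0 + 0) n = tens 0 n + tens 0 n]. *)
have -> : tensor_map (N := N) O v = 0.
  move: v; apply: (@tensor_ext _ _ _ _ _ (fun=> 0)) => [|s' t'|x n].
  - exact: tensor_map_is_additive.
  - by rewrite subrr.
  - have [bDl _ _] := @tens_balanced A X N.
    rewrite tensor_map_tens; apply: (@addrI _ (tens (0 : X) n)).
    by rewrite -bDl !addr0.
by move/esym/eqP; rewrite subr_eq0 => /eqP.
Qed.

Section Adjunction.
Variables (X : rmodType A) (M : rmodType B) (g : {linear X -> right_restr f M}).

(** The B-linear map adjoint to [g], sending x tensor b to g(x) b. *)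
Definition ext_transpose : ext_scalars X -> M :=
  tensor_lift (fun x (n : N) => (n : B^c) *: (g x : M)).

Lemma ext_transpose_balanced :
  balanced (fun x (n : N) => (n : B^c) *: (g x : M)).
Proof.
split=> *; first by rewrite linearD; exact: scalerDr.
  exact: scalerDl.
by rewrite linearZ; exact: scalerA.
Qed.

Lemma ext_transpose_tens x (n : N) :
  ext_transpose (tens x n) = (n : B^c) *: (g x : M).
Proof. exact: (tensor_lift_tens ext_transpose_balanced). Qed.

Lemma ext_transpose_is_linear : linear ext_transpose.
Proof.
pose G : {additive ext_scalars X -> M} := HB.pack ext_transpose
  (GRing.isZmodMorphism.Build _ _ _ (tensor_lift_is_additive ext_transpose_balanced)).
move=> b s t; rewrite -![ext_transpose _]/(G _) raddfD; congr (_ + _).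
move: s; apply: tensor_ext => [s u|s u|x n].
- by rewrite scalerBr raddfB.
- by rewrite raddfB scalerBr.
- by rewrite ext_scaleE /= !ext_transpose_tens scalerA.
Qed.
HB.instance Definition _ :=
  GRing.isLinear.Build B^c (ext_scalars X) M *:%R ext_transpose
    ext_transpose_is_linear.

End Adjunction.

Definition ext_unit X (x : X) : right_restr f (ext_scalars X) :=
  tens x ((1 : B) : N) : ext_scalars X.

Lemma ext_unit_is_linear X : linear (@ext_unit X).
Proof.
have [bDl bDr bM] := @tens_balanced A X N.
move=> a x y; rewrite /ext_unit bDl; congr (_ + _).
(* Both sides equal [tens x (f a)]: balancing moves [a] across to 1, and [f a] acts on 1 from the
   right. *)
rewrite bM; apply/esym; rewrite [LHS](@ext_scaleE X (f a)).
by congr tens; rewrite mul1r -[RHS]/(f a * 1) mulr1.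
Qed.

(** Transpose [g] to a B-linear map, extend it along the injective [ext_map u], and transpose back
    by composing the extension with [ext_unit]. *)
Lemma injective_in_restr M : flat N -> injective_in (@Mod B) M ->
  injective_in (@Mod A) (right_restr f M).
Proof.
move=> Nflat injM X Y u _ _ mu g.
have /(ext_map_inj Nflat) injeu : injective u.
  by apply/(monic_inP u (@closed_subcategory_all A^c) I).
pose eu : {linear ext_scalars X -> ext_scalars Y} := ext_map u.
have meu : monic_in (@Mod B) eu.
  exact: (monic_inP eu (@closed_subcategory_all B^c) I).2 injeu.
have [h hE] := injM _ _ eu I I meu (ext_transpose g).
pose H (y : Y) : right_restr f M := h (ext_unit y).
have Hlin : linear H.
  by move=> a x y; rewrite /H ext_unit_is_linear linearP.
pose HL : {linear Y -> right_restr f M} :=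
  HB.pack H (GRing.isLinear.Build A^c Y (right_restr f M) *:%R H Hlin).
exists HL => x; have := hE (tens x ((1 : B) : N)).
rewrite /= ext_transpose_tens scale1r => <-.
by rewrite /H /ext_unit /ext_map tensor_map_tens.
Qed.

End ExtensionOfScalars.

Theorem corollary1p7 (B : pzRingType) (C : rmodType B -> Prop) (E : set B)
    (M : rmodType B) :
  closed_subcategory C ->
  local_units (preradical_ideal C) E ->
  C M ->
  finite_support E M ->
  (injective_in (@Mod B) M <-> injective_in C M) /\
  (forall (A : pzRingType) (f : {rmorphism A -> B}),
    flat (left_regular_along f) ->
    injective_in C M -> injective_in (@Mod A) (right_restr f M)).
Proof.
move=> Ccl lu CM fs.
have CMod : injective_in C M -> injective_in (@Mod B) M.
  exact: injective_in_Mod Ccl lu fs.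
split; last by move=> A f fl /CMod; exact: injective_in_restr.
split=> //; apply: injective_in_sub => //; exact: closed_subcategory_all.
Qed.
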